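(* For all integers $n\ge 0$ and $d\ge 2$, $$ \mathcal{E}_n^{(d)} = \sum_{\pi\models_d [n]} (-1)^{\ell(\pi)}, $$ where the sum is over all $d$-divisible ordered set partitions $\pi$ of $[n]$.
   Context: For an integer $d\ge 2$, the generalized Euler numbers $\mathcal{E}_n^{(d)}$, $n\ge 0$, are defined by the formal power series identity $$ \sum_{n\ge 0}\mathcal{E}_n^{(d)}\frac{x^n}{n!}=\frac{1}{1+x^d/d!+x^{2d}/(2d)!+\cdots}=\frac{1}{\sum_{k\ge 0}x^{dk}/(dk)!}, $$ i.e. $\mathcal{E}_n^{(d)}$ is $n!$ times the coefficient of $x^n$ in the multiplicative inverse of the formal power series $\sum_{k\ge0}x^{dk}/(dk)!$ over $\mathbb{Q}$. $[n]=\{1,2,\dots,n\}$ (so $[0]=\emptyset$). An ordered set partition of a finite set $S$ is a sequence $\pi=(B_1,\dots,B_k)$ of nonempty subsets of $S$ (called blocks) whose disjoint union is $S$; the order of the blocks matters. Its length is $\ell(\pi)=k$, the number of blocks. The empty set has exactly one ordered set partition, the empty sequence, of length $0$. One writes $\pi\models_d S$, and calls $\pi$ $d$-divisible, if $\pi$ is an ordered set partition of $S$ such that every block has cardinality divisible by $d$. *)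

(* Defs.v *)
From HB Require Import structures.
From mathcomp Require Import all_boot all_order all_algebra.

Set Implicit Arguments.
Unset Strict Implicit.
Unset Printing Implicit Defensive.

Import Order.TTheory GRing.Theory Num.Theory.
Local Open Scope ring_scope.

(* A formal power series is its sequence of coefficients, f : nat -> R. *)

Definition ps_one (R : fieldType) : nat -> R := fun n => (n == 0)%:R.

Definition ps_mul (R : fieldType) (f g : nat -> R) : nat -> R :=
  fun n => \sum_(i < n.+1) f i * g (n - i)%N.

(* The first n coefficients of 1 / f, by the usual recursion
   g_0 = 1 / f_0,  g_m = - (\sum_(i < m) g_i f_(m - i)) / f_0. *)
Fixpoint ps_inv_seq (R : fieldType) (f : nat -> R) (n : nat) : seq R :=
  if n is m.+1 then
    let s := ps_inv_seq f m in
    rcons s ((ps_one R m - \sum_(i < m) s`_i * f (m - i)%N) / f 0)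
  else [::].

Definition ps_inv (R : fieldType) (f : nat -> R) : nat -> R :=
  fun n => (ps_inv_seq f n.+1)`_n.

Lemma size_ps_inv_seq (R : fieldType) (f : nat -> R) n :
  size (ps_inv_seq f n) = n.
Proof. by elim: n => //= n IHn; rewrite size_rcons IHn. Qed.

Lemma nth_ps_inv_seq (R : fieldType) (f : nat -> R) n i :
  (i < n)%N -> (ps_inv_seq f n)`_i = ps_inv f i.
Proof.
elim: n => // n IHn; rewrite ltnS leq_eqVlt => /predU1P[-> //|lt_in].
by rewrite /= nth_rcons size_ps_inv_seq lt_in IHn.
Qed.

Lemma ps_invP (R : fieldType) (f : nat -> R) :
  f 0 != 0 -> ps_mul (ps_inv f) f =1 ps_one R.
Proof.
move=> f0 n; rewrite /ps_mul big_ord_recr /= subnn {2}/ps_inv /=.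
rewrite nth_rcons size_ps_inv_seq ltnn eqxx divfK //.
under [X in _ - X]eq_bigr => i _ do rewrite nth_ps_inv_seq //.
by rewrite addrC subrK.
Qed.

Lemma ps_inv_unique (R : fieldType) (f g : nat -> R) :
  f 0 != 0 -> ps_mul g f =1 ps_one R -> g =1 ps_inv f.
Proof.
move=> f0 gf1; elim/ltn_ind => n IHn; apply: (mulIf f0).
have := gf1 n; rewrite -(ps_invP f0 n) /ps_mul !big_ord_recr /= subnn.
by under eq_bigr => i _ do rewrite IHn //; move/addrI.
Qed.

(* \sum_(k >= 0) x^(dk) / (dk)!, for d > 0. *)
Definition dexp_series (d : nat) : nat -> rat :=
  fun m => if (d %| m)%N then (m`!)%:R^-1 else 0.

Definition gen_euler (d n : nat) : rat :=
  (n`!)%:R * ps_inv (dexp_series d) n.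

Lemma gen_euler_egf (d : nat) :
  ps_mul (fun n => gen_euler d n / (n`!)%:R) (dexp_series d) =1 ps_one rat.
Proof.
have d0 : dexp_series d 0 != 0 by rewrite /dexp_series dvdn0 invr1 oner_eq0.
move=> n; rewrite -(ps_invP d0 n); apply: eq_bigr => i _.
by rewrite /gen_euler mulrC mulrAC mulfV ?mul1r 1?mulrC // pnatr_eq0 -lt0n fact_gt0.
Qed.

Definition ordered_set_partition (T : finType) (S : {set T})
    (p : seq {set T}) : bool :=
  [&& set0 \notin p,
      pairwise (fun A B : {set T} => [disjoint A & B]) p
    & \bigcup_(B <- p) B == S].

Definition ddivisible_osp (T : finType) (d : nat) (S : {set T})
    (p : seq {set T}) : bool :=
  ordered_set_partition S p && all (fun B : {set T} => d %| #|B|)%N p.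

(* A sum over the finite type {bseq #|S| of {set T}}, of sequences of length at
   most #|S|, therefore misses no ordered set partition of S. *)
Lemma size_ordered_set_partition (T : finType) (S : {set T})
    (p : seq {set T}) :
  ordered_set_partition S p -> (size p <= #|S|)%N.
Proof.
elim: p S => [//|B p IHp] S.
rewrite /ordered_set_partition inE negb_or big_cons.
case/and3P=> /andP[B0 p0] /= /andP[dB dp] /eqP <-.
have /IHp le_p : ordered_set_partition (\bigcup_(C <- p) C) p.
  by rewrite /ordered_set_partition p0 dp eqxx.
have -> : #|B :|: \bigcup_(C <- p) C| = (#|B| + #|\bigcup_(C <- p) C|)%N.
  rewrite cardsU disjoint_setI0 ?cards0 ?subn0 // bigcup_seq.
  by apply/bigcup_disjointP => C Cp; apply: (allP dB).
by rewrite -add1n leq_add // card_gt0 eq_sym.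
Qed.

(* Main.v *)
Require Import Defs.
From mathcomp Require Import all_boot all_order all_algebra.

(** Both sides satisfy the recursion that determines the generalized Euler
    numbers [E_n].  Multiplying the generating function by its denominator and
    comparing coefficients of [x^n / n!] gives
      [\sum_(k <= n, d | k) 'C(n, k) E_(n - k) = (n == 0)],
    which, read as a sum over the subsets [B] of an [n]-element set [S] with
    [d | #|B|], is [gen_euler_subset_sum].

    On the other side, the [d]-divisible ordered partitions of a nonempty set
    [S] are the [B :: q] where [B] is a nonempty subset of [S] with [d | #|B|]
    and [q] is a [d]-divisible ordered partition of [S :\: B].  Removing the
    first block changes the sign, so the signed count [F] satisfies
    [F S = - \sum_B F (S :\: B)], the sum being over nonempty
    [B \subset S] with [d | #|B|].  Moving the sum to the left, where
    [F S] is the term of [B = set0], yields the same recursion, and the theorem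
    follows by induction on a bound for [#|S|].  Since removing a block leaves
    subsets of the ground set, the induction is over all finite sets [S] and
    not only the full set. *)

Set Implicit Arguments.
Unset Strict Implicit.
Unset Printing Implicit Defensive.

Import Order.TTheory GRing.Theory Num.Theory.
Local Open Scope ring_scope.

(** The tail of a [{bseq m.+1 of T}] lives in another type, so the two index
    sets are compared through their enumerations as plain sequences. *)
Lemma big_bseqS (R : Type) (idx : R) (op : Monoid.com_law idx) (T : finType)
    (m : nat) (G : seq T -> R) :
  \big[op/idx]_(p : {bseq m.+1 of T}) G p =
  op (G [::]) (\big[op/idx]_(x : T) \big[op/idx]_(q : {bseq m of T}) G (x :: q)).
Proof.
pose conses := [seq x :: val q | x <- enum T, q <- enum {bseq m of T}].
have enum_bseqS : perm_eq (map val (enum {bseq m.+1 of T})) ([::] :: conses).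
  apply: uniq_perm.
  - by rewrite map_inj_uniq ?enum_uniq //; apply: val_inj.
  - rewrite /=; apply/andP; split; first by apply/allpairsP => -[[x q] /= []].
    apply: allpairs_uniq; rewrite ?enum_uniq // => -[x q] [y r] _ _ /= [-> qr].
    by rewrite (val_inj qr).
  - move=> s; apply/mapP/idP => [[p _ ->]|].
      case: p => -[|x p] //= le_p; rewrite inE; apply/allpairsP.
      by exists (x, Bseq (le_p : (size p <= m)%N)); rewrite !mem_enum.
    rewrite inE => /predU1P[->|/allpairsP[[x q] /= [_ _ ->]]].
      by exists [bseq]; rewrite ?mem_enum.
    by exists (Bseq (size_bseq q : (size (x :: q) <= m.+1)%N)); rewrite ?mem_enum.
rewrite -big_enum -(big_map val xpredT G) (perm_big _ enum_bseqS) big_cons.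
rewrite big_allpairs_dep -big_enum; congr (op _ _); apply: eq_bigr => x _.
by rewrite -big_enum.
Qed.

Lemma sum_subset_card (V : nmodType) (T : finType) (S : {set T})
    (f : nat -> V) :
  \sum_(B : {set T} | B \subset S) f #|B| =
  \sum_(k < #|S|.+1) f k *+ 'C(#|S|, k).
Proof.
rewrite (partition_big (fun B : {set T} => inord #|B| : 'I_#|S|.+1) xpredT) //=.
apply: eq_bigr => k _; rewrite -cards_draws -sumr_const.
have card_inord (B : {set T}) : B \subset S ->
    (inord #|B| == k :> 'I_#|S|.+1) = (#|B| == k).
  by move=> sBS; rewrite -val_eqE /= inordK // ltnS subset_leq_card.
apply: eq_big => [B|B /andP[sBS]]; last by rewrite card_inord // => /eqP->.
by rewrite inE; case sBS: (B \subset S) => //=; apply: card_inord.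
Qed.

(** Multiplying the coefficient identity of [gen_euler_egf] by [n!] turns the
    quotients of factorials into binomial coefficients. *)
Lemma gen_euler_rec (d n : nat) :
  \sum_(k < n.+1 | (d %| k)%N) gen_euler d (n - k) *+ 'C(n, k) = (n == 0)%:R.
Proof.
have fact_neq0 m : (m`!)%:R != 0 :> rat by rewrite pnatr_eq0 -lt0n fact_gt0.
transitivity ((n`!)%:R * ps_one rat n); last first.
  by rewrite /ps_one; case: n => [|n]; rewrite ?mulr1 ?mulr0.
rewrite -(gen_euler_egf d n) mulr_sumr (reindex_inj rev_ord_inj) big_mkcond /=.
apply: eq_bigr => i _; have le_in : (i <= n)%N by rewrite -ltnS.
rewrite subSS subKn // /dexp_series; case: ifP => _; last by rewrite !mulr0.
rewrite bin_sub // -[LHS]mulr_natl -(bin_fact le_in) !natrM -[_ / _ / _]mulrA -invfM.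
by rewrite mulrACA divff ?mulr1 // mulf_neq0.
Qed.

(** A subset [B] of size [k] contributes [gen_euler d (#|S| - k)], and there are
    ['C(#|S|, k)] of them. *)
Lemma gen_euler_subset_sum (T : finType) (d : nat) (S : {set T}) :
  \sum_(B : {set T} | (B \subset S) && (d %| #|B|)%N) gen_euler d #|S :\: B| =
  (S == set0)%:R.
Proof.
pose f k := if (d %| k)%N then gen_euler d (#|S| - k) else 0.
rewrite -cards_eq0 -(gen_euler_rec d) [RHS]big_mkcond big_mkcondr /=.
transitivity (\sum_(B : {set T} | B \subset S) f #|B|).
  by apply: eq_bigr => B sBS; rewrite /f cardsD (setIidPr sBS).
rewrite sum_subset_card; apply: eq_bigr => k _; rewrite /f.
by case: ifP => // _; rewrite mul0rn.
Qed.

Lemma ddivisible_osp_cons (T : finType) (d : nat) (S B : {set T})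
    (q : seq {set T}) :
  ddivisible_osp d S (B :: q) =
  [&& (B \subset S) && (d %| #|B|)%N, B != set0 & ddivisible_osp d (S :\: B) q].
Proof.
have disjoint_cover :
    all (fun C : {set T} => [disjoint B & C]) q = [disjoint B & \bigcup_(C <- q) C].
  rewrite bigcup_seq; apply/allP/idP => [dB|dB C Cq].
    by apply/bigcup_disjointP.
  by apply: disjointWr dB; apply: bigcup_sup.
(* [U] stands for the union of [q]: this trades the conditions linking [q] to
   the first block for the single condition on what [q] has to partition. *)
have complement (U : {set T}) :
    [disjoint B & U] && (B :|: U == S) = (B \subset S) && (U == S :\: B).
  apply/andP/andP=> [[dBU /eqP <-]|[sBS /eqP ->]].
    rewrite subsetUl setDUl setDv set0U eq_sym; split=> //.
    by apply/eqP/setDidPl; rewrite disjoint_sym.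
  have defS : B :|: S :\: B = S by rewrite -[X in X :|: _](setIidPr sBS) setID.
  by rewrite defS -setI_eq0 setDE setICA setICr setI0.
rewrite /ddivisible_osp /ordered_set_partition inE negb_or big_cons /=.
rewrite disjoint_cover [set0 == B]eq_sym andbACA -!andbA.
have := complement (\bigcup_(C <- q) C); case: (B != set0); last by rewrite !andbF.
case: (set0 \notin q); last by rewrite !andbF.
case: (pairwise _ q); last by rewrite !andbF.
case: (d %| #|B|)%N; last by rewrite !andbF.
by rewrite !andTb !andbA => ->.
Qed.

Lemma ddivisible_osp_set0 (T : finType) (d : nat) (p : seq {set T}) :
  ddivisible_osp d set0 p = (p == [::]).
Proof.
apply/idP/eqP => [/andP[/size_ordered_set_partition]|->].
  by rewrite cards0 leqn0 size_eq0 => /eqP.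
by rewrite /ddivisible_osp /ordered_set_partition big_nil eqxx.
Qed.

(** The bound [m] is kept apart from [#|S|] so that the induction hypothesis,
    which concerns sequences of length at most [m], applies to every [S :\: B]
    whatever the size of the block [B]. *)
Lemma signed_count_gen_euler (T : finType) (d m : nat) (S : {set T}) :
  (#|S| <= m)%N ->
  \sum_(p : {bseq m of {set T}} | ddivisible_osp d S p) (-1) ^+ size p =
  gen_euler d #|S|.
Proof.
have count0 k : \sum_(p : {bseq k of {set T}} | ddivisible_osp d set0 p)
    (-1) ^+ size p = gen_euler d #|@set0 T|.
  rewrite (big_pred1 [bseq]) => [|p]; last exact: ddivisible_osp_set0.
  have := gen_euler_subset_sum d (@set0 T); rewrite eqxx (big_pred1 set0) => [|B].
    by rewrite setD0 => ->.
  by rewrite subset0 /=; case: (eqVneq B set0) => // ->; rewrite cards0 dvdn0.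
elim: m S => [|m IHm] S le_S_m.
  by move: le_S_m; rewrite leqn0 cards_eq0 => /eqP->.
have [->|S_neq0] := eqVneq S set0; first exact: count0.
(* The term [B = set0] of the recursion is the number to be computed. *)
have := gen_euler_subset_sum d S.
rewrite (negPf S_neq0) (bigD1 set0) /=; last by rewrite sub0set cards0 dvdn0.
rewrite setD0 => /eqP; rewrite addr_eq0 => /eqP->.
rewrite big_mkcond (big_bseqS _ _ (fun p : seq {set T} =>
  if ddivisible_osp d S p then (-1) ^+ size p else 0)).
have -> : ddivisible_osp d S [::] = false.
  by rewrite /ddivisible_osp /ordered_set_partition big_nil eq_sym (negPf S_neq0).
rewrite /= add0r.
rewrite -sumrN [RHS]big_mkcond; apply: eq_bigr => B _.
under eq_bigr => q _ do rewrite ddivisible_osp_cons andbA.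
case: ifP => [/andP[/andP[sBS _] B_neq0]|_]; last by rewrite big1.
have lt_SB_S : (#|S :\: B| < #|S|)%N.
  rewrite proper_card // properEneq subsetDl andbT.
  by apply: contraNneq B_neq0 => /setDidPl; rewrite -setI_eq0 (setIidPr sBS).
rewrite -IHm; last by rewrite -ltnS (leq_trans lt_SB_S).
by rewrite -sumrN -big_mkcond; apply: eq_bigr => q _; rewrite exprS mulN1r.
Qed.

Theorem theorem1p1 (n d : nat) (hd : (2 <= d)%N) :
  gen_euler d n =
  \sum_(p : {bseq n of {set 'I_n}} | ddivisible_osp d [set: 'I_n] p)
    (-1) ^+ size p.
Proof. by rewrite signed_count_gen_euler cardsT card_ord. Qed.
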